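(* For each integer $d\ge 1$, let $f_d(x)=\frac{U_{d-1}(x)}{x\,U_d(x)}$ for $x\in[1,\infty)$. Then for all $x\in[1,\infty)$, $$f_d(x)=\sum_{i=0}^{\infty}\frac{\Delta_{i,d-1}}{2^{2i+1}x^{2i+2}}.$$
   Context: $U_k$ denotes the Chebyshev polynomial of the second kind: $U_0(X)=1$, $U_1(X)=2X$, $U_{k+1}(X)=2XU_k(X)-U_{k-1}(X)$. For $n,h\ge 0$, $\Delta_{n,h}$ denotes the number of Dyck paths of semilength $n$ and of maximum height $h$, i.e. lattice walks from $(0,0)$ to $(2n,0)$ with steps $(1,1)$ and $(1,-1)$ whose height always stays in the interval $[0,h]$ (the height bound $h$ need not be attained). In particular $\Delta_{0,h}=1$ for all $h\ge 0$ and $\Delta_{n,0}=0$ for $n\ge 1$. *)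

(* Defs.v *)
From mathcomp Require Import all_boot all_order all_algebra.
From mathcomp Require Import all_classical all_reals all_analysis.
Set Implicit Arguments.
Unset Strict Implicit.
Unset Printing Implicit Defensive.
Import Order.TTheory GRing.Theory Num.Theory.
Import numFieldNormedType.Exports.
Local Open Scope ring_scope.

Fixpoint chebyshevU (R : nzRingType) (k : nat) : {poly R} :=
  if k is k1.+1 then
    if k1 is k2.+1 then 2%:R *: 'X * chebyshevU R k1 - chebyshevU R k2
    else 2%:R *: 'X
  else 1.

(* A walk is encoded by its sequence of steps: [true] is the step (1,1) and
   [false] is the step (1,-1). *)
Definition step (b : bool) : int := if b then 1 else -1.

(* Ordinate after the first [k] steps, starting from ordinate 0. Since heights
   are integers, they are constrained at integer abscissas only, which is the
   same as constraining the whole piecewise linear path. *)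
Definition height (w : seq bool) (k : nat) : int :=
  \sum_(b <- take k w) step b.

(* The height bound [h] need not be attained. *)
Definition dyck_paths (n h : nat) : {set (2 * n).-tuple bool} :=
  [set w : (2 * n).-tuple bool |
    (height w (2 * n) == 0) &&
    [forall k : 'I_(2 * n).+1, 0 <= height w k <= h%:Z]].

Definition Delta (n h : nat) : nat := #|dyck_paths n h|.

(* Intended for [1 <= d] and [1 <= x], where the denominator does not vanish. *)
Definition cheb_ratio (R : realType) (d : nat) (x : R) : R :=
  (chebyshevU R (d - 1)).[x] / (x * (chebyshevU R d).[x]).

(* Main.v *)
Require Import Defs.
From mathcomp Require Import all_boot all_order all_algebra.
From mathcomp Require Import all_classical all_reals all_analysis.
From mathcomp Require Import ring lra zify.
Import Order.TTheory GRing.Theory Num.Theory.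
Import numFieldNormedType.Exports.
Local Open Scope classical_set_scope.
Local Open Scope ring_scope.

(** Let [h = d - 1] and let [B] be the adjacency operator of the path graph on
    the heights [0, ..., h]. Walks that stay in the strip and end at height 0
    are counted by the powers of [B] applied to the indicator [e0] of height 0:
    [Delta i h] is the value at 0 of [B^(2i) e0], and the odd powers vanish
    there by parity.

    Put [t = 1 / (2x)]. The Chebyshev recurrence says that the vector
    [v j = U_(h-j)(x)] satisfies [v = t U_d(x) e0 + t B v]: the upper boundary
    is respected because [U_1 = 2x U_0], and the lower one is responsible for
    the source term [U_d(x) e0]. Iterating this equation ([resolvent_expansion])
    gives
      [U_(d-1)(x) = t U_d(x) \sum_(k < m) t^k (B^k e0)(0) + t^m (B^m v)(0)],
    which, divided by [x U_d(x)] and taken for [m = 2n], is the claim up to the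
    remainder.

    The remainder tends to 0 even at the endpoint [x = 1], where [t = 1/2],
    since the strip has absorbing ends: the concave weight
    [w j = (j+1)(h+1-j)] satisfies [(1/2) B w <= w - 1 <= rho w] with
    [rho < 1] ([strip_weight_contracts]), so that [t^m B^m v] decays like
    [rho^m] ([iter_strip_adj_le]). *)

(** * The adjacency operator of a strip *)

Definition strip_adj {R : nzRingType} (h : nat) (f : nat -> R) (j : nat) : R :=
  (if (j < h)%N then f j.+1 else 0) + (if (0 < j)%N then f j.-1 else 0).

Definition at_bottom {R : nzRingType} (j : nat) : R := (j == 0)%:R.

(** Each step changes the parity of the height. *)
Lemma iter_strip_adj_odd (R : nzRingType) (h k j : nat) :
  odd (k + j) -> iter k (strip_adj h) at_bottom j = 0 :> R.
Proof.
elim: k j => [|k IHk] j; first by case: j.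
rewrite addSn /= => ev; rewrite /strip_adj IHk ?addnS // if_same add0r.
by case: j ev => //= j; rewrite addnS /= negbK => /IHk.
Qed.

Lemma strip_adj_sum (R : nzRingType) (h m : nat) (f : nat -> nat -> R)
    (j : nat) :
  strip_adj h (fun i => \sum_(0 <= k < m) f k i) j
    = \sum_(0 <= k < m) strip_adj h (f k) j.
Proof.
by rewrite /strip_adj; case: ifP => _; case: ifP => _;
  rewrite big_split /= ?big1_eq.
Qed.

Lemma strip_adjZ (R : comNzRingType) (h : nat) (a : R) (f : nat -> R) (j : nat) :
  strip_adj h (fun i => a * f i) j = a * strip_adj h f j.
Proof. by rewrite /strip_adj; case: ifP => _; case: ifP => _; ring. Qed.

Lemma strip_adjD (R : nzRingType) (h : nat) (f g : nat -> R) (j : nat) :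
  strip_adj h (fun i => f i + g i) j = strip_adj h f j + strip_adj h g j.
Proof.
by rewrite /strip_adj; case: ifP => _; case: ifP => _;
  rewrite ?addr0 ?add0r // addrACA.
Qed.

Lemma eq_strip_adj (R : nzRingType) (h : nat) (f g : nat -> R) (j : nat) :
    (forall i, (i <= h)%N -> f i = g i) -> (j <= h)%N ->
  strip_adj h f j = strip_adj h g j.
Proof.
move=> fg jh; rewrite /strip_adj.
by congr (_ + _); case: ifP => // ?; apply: fg; lia.
Qed.

(** The Neumann series of [1 - t B], truncated with its exact remainder. *)
Lemma resolvent_expansion (R : comNzRingType) (h : nat) (t c : R)
    (v : nat -> R) (m : nat) :
    (forall j, (j <= h)%N -> v j = c * at_bottom j + t * strip_adj h v j) ->
  forall j, (j <= h)%N ->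
    v j = c * (\sum_(0 <= k < m) t ^+ k * iter k (strip_adj h) at_bottom j)
          + t ^+ m * iter m (strip_adj h) v j.
Proof.
move=> veq; elim: m => [|m IHm] j jh.
  by rewrite big_geq // mulr0 add0r mul1r.
rewrite {1}veq // (eq_strip_adj _ _ _ _ _ IHm jh) strip_adjD !strip_adjZ.
rewrite strip_adj_sum big_nat_recl //= expr0 mul1r.
under [in RHS]eq_bigr do rewrite exprS -mulrA.
under [in LHS]eq_bigr do rewrite strip_adjZ.
rewrite -mulr_sumr exprS; ring.
Qed.

Lemma iter_strip_adj_ge0 (R : realFieldType) (h : nat) (v : nat -> R) (m : nat) :
    (forall j, (j <= h)%N -> 0 <= v j) ->
  forall j, (j <= h)%N -> 0 <= iter m (strip_adj h) v j.
Proof.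
move=> v0; elim: m => [|m IHm] j jh /=; first exact: v0.
by rewrite /strip_adj; apply: addr_ge0; case: ifP => // ?; apply: IHm; lia.
Qed.

(** A positive operator that contracts one majorant contracts everything below
    it. *)
Lemma iter_strip_adj_le (R : realFieldType) (h : nat) (t rho C : R)
    (v w : nat -> R) (m : nat) :
    0 <= t -> 0 <= rho -> 0 <= C ->
    (forall j, (j <= h)%N -> v j <= C * w j) ->
    (forall j, (j <= h)%N -> t * strip_adj h w j <= rho * w j) ->
  forall j, (j <= h)%N ->
    t ^+ m * iter m (strip_adj h) v j <= C * rho ^+ m * w j.
Proof.
move=> t0 rho0 C0 vw tw; elim: m => [|m IHm] j jh /=.
  by rewrite !expr0 mul1r mulr1 vw.
rewrite [t ^+ _]exprS -mulrA -strip_adjZ.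
have -> : C * rho ^+ m.+1 * w j = (C * rho ^+ m) * (rho * w j).
  by rewrite exprS; ring.
have K0 : 0 <= C * rho ^+ m by rewrite mulr_ge0 // exprn_ge0.
apply: le_trans (ler_wpM2l K0 (tw j jh)).
rewrite mulrCA ler_wpM2l // /strip_adj mulrDr.
by apply: lerD; case: ifP => ?; rewrite ?mulr0 // IHm //; lia.
Qed.

Definition strip_weight {R : nzRingType} (h j : nat) : R :=
  (j.+1 * (h.+1 - j))%:R.

Lemma strip_weight_ge1 (R : realFieldType) (h j : nat) :
  (j <= h)%N -> 1 <= strip_weight h j :> R.
Proof. by move=> jh; rewrite /strip_weight ler1n muln_gt0 /= subn_gt0. Qed.

(** The weight vanishes just outside the strip and its second difference is the
    constant -2, so averaging over neighbours lowers it by exactly 1. As the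
    weight is at most [(h+1)^2], this is a loss of a fixed proportion. *)
Lemma strip_weight_contracts (R : realFieldType) (h : nat) (t : R) (j : nat) :
    0 <= t <= 2^-1 -> (j <= h)%N ->
  t * strip_adj h (strip_weight h) j
    <= (1 - (h.+1%:R ^+ 2)^-1) * strip_weight h j.
Proof.
move=> /andP[t0 t2] jh.
have adjE : strip_adj h (strip_weight h) j = 2 * (strip_weight h j - 1) :> R.
  rewrite /strip_adj /strip_weight -(natrB _ (n := 1%N)); last by nia.
  rewrite -natrM.
  (* The 0 of a missing neighbour has to be a cast as well. *)
  by case: ifP => ?; case: ifP => ?; rewrite -?[0]/(0%:R) -natrD;
    congr _%:R; nia.
have w1 := strip_weight_ge1 R _ _ jh.
have wM : (h.+1%:R ^+ 2)^-1 * strip_weight h j <= 1 :> R.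
  rewrite mulrC ler_pdivrMr ?exprn_gt0 ?ltr0n // mul1r /strip_weight -natrX ler_nat.
  by nia.
rewrite adjE mulrBl mul1r.
apply: (@le_trans _ _ (strip_weight h j - 1)); last by rewrite lerD2l lerN2.
by rewrite mulrA ler_piMl ?subr_ge0 //; lra.
Qed.

(** * Counting walks by powers of the adjacency operator *)

(** The condition defining [dyck_paths], generalized to an arbitrary starting
    height and checked step by step, so that removing the first step of a walk
    gives the recurrence [strip_adj]. *)
Fixpoint confined (h : nat) (z : int) (w : seq bool) : bool :=
  (0 <= z <= h%:Z) &&
  (if w is b :: w' then confined h (z + step b) w' else z == 0).

Lemma height_cons (b : bool) (w : seq bool) (k : nat) :
  height (b :: w) k.+1 = step b + height w k.
Proof. by rewrite /height /= big_cons. Qed.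

Lemma height0 (w : seq bool) : height w 0 = 0.
Proof. by rewrite /height take0 big_nil. Qed.

Lemma confinedE (h : nat) (z : int) (w : seq bool) :
  confined h z w =
    (z + height w (size w) == 0) &&
    all (fun k => 0 <= z + height w k <= h%:Z) (iota 0 (size w).+1).
Proof.
elim: w z => [|b w IHw] z.
  by rewrite /= height0 addr0 andbT andbC.
rewrite [confined _ _ _]/= IHw [size (b :: w)]/= height_cons addrA.
have -> : iota 0 (size w).+2 = 0%N :: map S (iota 0 (size w).+1).
  exact: (congr1 (cons 0%N) (iotaDl 1 0 (size w).+1)).
rewrite [all _ (_ :: _)]/= height0 addr0 andbCA all_map; do 2!congr (_ && _).
by apply: eq_all => k /=; rewrite height_cons addrA.
Qed.

Lemma dyck_paths_confined (n h : nat) (w : (2 * n).-tuple bool) :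
  (w \in dyck_paths n h) = confined h 0 w.
Proof.
rewrite inE confinedE size_tuple add0r; congr (_ && _).
apply/forallP/allP => [Hw k|Hw k].
  by rewrite mem_iota add0n /= add0r => kn; exact: (Hw (Ordinal kn)).
by have := Hw k; rewrite add0r; apply; rewrite mem_iota add0n /=.
Qed.

Lemma big_tuple_cons (R : nmodType) (T : finType) (k : nat) (F : seq T -> R) :
  \sum_(w : k.+1.-tuple T) F w = \sum_(b : T) \sum_(w : k.-tuple T) F (b :: w).
Proof.
rewrite pair_bigA /=.
rewrite (reindex (fun p : T * k.-tuple T => [tuple of p.1 :: p.2])) //=.
exists (fun w : k.+1.-tuple T => (thead w, [tuple of behead w])).
  by move=> [b w] _ /=; congr (_, _); apply: val_inj.
by move=> w _ /=; rewrite [RHS]tuple_eta.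
Qed.

Lemma confined_out (h : nat) (z : int) (w : seq bool) :
  ~~ (0 <= z <= h%:Z) -> confined h z w = false.
Proof. by case: w => [|b w] /= /negbTE->. Qed.

Lemma sum_confined (R : nzRingType) (h k j : nat) : (j <= h)%N ->
  \sum_(w : k.-tuple bool) (confined h j%:Z w)%:R
    = iter k (strip_adj h) at_bottom j :> R.
Proof.
elim: k j => [|k IHk] j jh.
  rewrite (big_pred1 [tuple]) => [|w]; last by rewrite [w]tuple0 /= eqxx.
  by rewrite /= lez_nat jh /at_bottom eqz_nat.
rewrite (big_tuple_cons R _ k (fun w => (confined h j%:Z w)%:R)).
rewrite big_bool /= lez_nat jh /= /strip_adj; congr (_ + _).
- have -> : j%:Z + step true = j.+1%:Z by rewrite /step; lia.
  case: ifP => [jlt|jge]; first exact: IHk.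
  by rewrite big1 // => w _; rewrite confined_out // lez_nat jge andbF.
- case: j jh => [|j] jh /=.
    by rewrite big1 // => w _; rewrite confined_out.
  have -> : j.+1%:Z + step false = j%:Z by rewrite /step; lia.
  by apply: IHk; exact: ltnW.
Qed.

Lemma Delta_iter (R : nzRingType) (n h : nat) :
  (Delta n h)%:R = iter (2 * n) (strip_adj h) at_bottom 0 :> R.
Proof.
rewrite -sum_confined // /Delta -sum1_card natr_sum big_mkcond /=.
by apply: eq_bigr => w _; rewrite dyck_paths_confined; case: confined.
Qed.

(** Odd lengths contribute nothing, so the series over all lengths is a series
    over semilengths. *)
Lemma sum_iter_Delta (R : comNzRingType) (h n : nat) (t : R) :
  \sum_(0 <= k < 2 * n) t ^+ k * iter k (strip_adj h) at_bottom 0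
    = \sum_(0 <= i < n) t ^+ (2 * i) * (Delta i h)%:R.
Proof.
elim: n => [|n IHn]; first by rewrite muln0 !big_geq.
rewrite mulnS !add2n !big_nat_recr //= IHn Delta_iter.
rewrite -[strip_adj h _]/(iter (2 * n).+1 (strip_adj h) at_bottom).
by rewrite iter_strip_adj_odd ?mulr0 ?addr0 // addn0 /= oddM.
Qed.

(** * Chebyshev polynomials on the half-line [x >= 1] *)

Lemma chebyshevU_horner0 (R : comNzRingType) (x : R) :
  (chebyshevU R 0).[x] = 1.
Proof. exact: hornerC. Qed.

Lemma chebyshevU_horner1 (R : comNzRingType) (x : R) :
  (chebyshevU R 1).[x] = 2 * x.
Proof. by rewrite /= hornerZ hornerX. Qed.

Lemma chebyshevU_hornerSS (R : comNzRingType) (k : nat) (x : R) :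
  (chebyshevU R k.+2).[x]
    = 2 * x * (chebyshevU R k.+1).[x] - (chebyshevU R k).[x].
Proof.
rewrite -[chebyshevU R k.+2]/(2%:R *: 'X * chebyshevU R k.+1 - chebyshevU R k).
by rewrite hornerD hornerN hornerM hornerZ hornerX.
Qed.

Lemma chebyshevU_gt0_le (R : realFieldType) (x : R) (k : nat) : 1 <= x ->
  0 < (chebyshevU R k).[x] <= (chebyshevU R k.+1).[x].
Proof.
move=> x1; elim: k => [|k /andP[IH0 IH1]].
  by rewrite chebyshevU_horner0 chebyshevU_horner1; lra.
rewrite chebyshevU_hornerSS; nra.
Qed.

Lemma chebyshevU_gt0 (R : realFieldType) (x : R) (k : nat) : 1 <= x ->
  0 < (chebyshevU R k).[x].
Proof. by move=> /(chebyshevU_gt0_le _ _ k) /andP[]. Qed.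

Lemma chebyshevU_le (R : realFieldType) (x : R) (k l : nat) : 1 <= x ->
  (k <= l)%N -> (chebyshevU R k).[x] <= (chebyshevU R l).[x].
Proof.
move=> x1; elim: l => [|l IHl]; first by rewrite leqn0 => /eqP->.
rewrite leq_eqVlt => /predU1P[-> //|]; rewrite ltnS => /IHl kl.
by apply: le_trans kl _; case/andP: (chebyshevU_gt0_le _ _ l x1).
Qed.

(** Read from the top of the strip downwards, the Chebyshev recurrence is an
    eigenvector equation for the adjacency operator, except at the bottom where
    the missing neighbour would carry [U_(h+1)]. *)
Lemma chebyshevU_strip_adj (R : comNzRingType) (h : nat) (x : R) (j : nat) :
    (j <= h)%N ->
  2 * x * (chebyshevU R (h - j)).[x]
    = (chebyshevU R h.+1).[x] * at_bottom j
      + strip_adj h (fun i => (chebyshevU R (h - i)).[x]) j.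
Proof.
move=> jh.
have below : (chebyshevU R (h - j).+1).[x]
    = (chebyshevU R h.+1).[x] * at_bottom j
      + (if (0 < j)%N then (chebyshevU R (h - j.-1)).[x] else 0).
  rewrite /at_bottom; case: j jh => [|j] jh.
    by rewrite subn0 mulr1 addr0.
  by rewrite subnSK // mulr0 add0r.
rewrite /strip_adj addrCA -below; case: ifP => [jlt|jge].
  have -> : (h - j = (h - j.+1).+1)%N by lia.
  by rewrite chebyshevU_hornerSS addrC subrK.
have -> : (h - j = 0)%N by lia.
by rewrite chebyshevU_horner0 chebyshevU_horner1 mulr1 add0r.
Qed.

(** * Convergence of the expansion *)

(** As [strip_weight] is at least 1 on the strip, [v 0] times the weight is a
    majorant of [v], and it is contracted at a rate below 1. *)
Lemma strip_remainder_cvg0 (R : realType) (h : nat) (t : R) (v : nat -> R) :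
    0 <= t <= 2^-1 ->
    (forall j, (j <= h)%N -> 0 <= v j <= v 0%N) ->
  (fun m => t ^+ m * iter m (strip_adj h) v 0) @ \oo --> (0 : R).
Proof.
move=> t2 vb; have /andP[t0 _] := t2.
set rho : R := 1 - (h.+1%:R ^+ 2)^-1.
have rho0 : 0 <= rho.
  by rewrite subr_ge0 invf_le1 ?exprn_gt0 ?ltr0n // exprn_ege1 // ler1n.
have rho1 : rho < 1 by rewrite gtrBl invr_gt0 exprn_gt0 ?ltr0n.
have v00 : 0 <= v 0%N by case/andP: (vb 0%N isT).
have upper_cvg0 :
    (fun m => v 0%N * rho ^+ m * strip_weight h 0) @ \oo --> (0 : R).
  rewrite (_ : 0 = v 0%N * 0 * strip_weight h 0); last by rewrite mulr0 mul0r.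
  apply: cvgM; last exact: cvg_cst.
  by apply: cvgM; [exact: cvg_cst|apply: cvg_expr; rewrite ger0_norm].
apply: (squeeze_cvgr _ (cvg_cst 0) upper_cvg0).
near=> m; apply/andP; split.
  rewrite mulr_ge0 ?exprn_ge0 // iter_strip_adj_ge0 // => j jh.
  by case/andP: (vb j jh).
apply: iter_strip_adj_le => // j jh; last exact: strip_weight_contracts.
case/andP: (vb j jh) => _ vj; apply: le_trans vj _.
by rewrite ler_peMr // strip_weight_ge1.
Unshelve. all: by end_near.
Qed.

(** This is [resolvent_expansion] for the vector [U_(h-j)(x)] and
    [t = 1 / (2x)], read at the bottom of the strip. Division by [x U_(h+1)(x)]
    turns the source coefficient [t U_(h+1)(x)] into the factor [1 / (2x^2)]
    that separates the series in [t] from the one in the statement. *)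
Lemma cheb_partial_sum (R : realType) (h n : nat) (x : R) : 1 <= x ->
  \sum_(0 <= i < n) (Delta i h)%:R / (2 ^+ (2 * i + 1) * x ^+ (2 * i + 2))
  = cheb_ratio h.+1 x
    - (x * (chebyshevU R h.+1).[x])^-1
      * ((2 * x)^-1 ^+ (2 * n)
         * iter (2 * n) (strip_adj h) (fun j => (chebyshevU R (h - j)).[x]) 0).
Proof.
move=> x1; have x0 : x != 0 by lra.
have U0 : (chebyshevU R h.+1).[x] != 0 by rewrite gt_eqF ?chebyshevU_gt0.
have veq j : (j <= h)%N -> (chebyshevU R (h - j)).[x]
    = ((2 * x)^-1 * (chebyshevU R h.+1).[x]) * at_bottom j
      + (2 * x)^-1 * strip_adj h (fun i => (chebyshevU R (h - i)).[x]) j.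
  move=> jh; rewrite -mulrA -mulrDr -chebyshevU_strip_adj // mulKf //.
  by rewrite mulf_neq0 ?pnatr_eq0.
have := resolvent_expansion _ _ _ _ _ (2 * n) veq 0 (leq0n h).
rewrite subn0 sum_iter_Delta /cheb_ratio subSS subn0.
have -> : \sum_(0 <= i < n)
      (Delta i h)%:R / (2 ^+ (2 * i + 1) * x ^+ (2 * i + 2))
    = (2 * x ^+ 2)^-1 *
      \sum_(0 <= i < n) (2 * x)^-1 ^+ (2 * i) * (Delta i h)%:R.
  rewrite mulr_sumr; apply: eq_bigr => i _.
  rewrite exprVn exprMn !exprD expr1; field.
  by rewrite x0 !expf_neq0 ?pnatr_eq0.
set err := _ * iter _ _ _ _ => ->; field; by rewrite x0 U0.
Qed.

Theorem theorem13 (R : realType) (d : nat) (hd : (1 <= d)%N) (x : R)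
    (hx : 1 <= x) :
  (fun n : nat => \sum_(0 <= i < n)
     (Delta i (d - 1))%:R / (2 ^+ (2 * i + 1) * x ^+ (2 * i + 2)))
    @ \oo --> cheb_ratio d x.
Proof.
case: d hd => [//|h] _; rewrite subSS subn0.
pose rem (m : nat) : R := (2 * x)^-1 ^+ m
  * iter m (strip_adj h) (fun j => (chebyshevU R (h - j)).[x]) 0.
pose inv : R := (x * (chebyshevU R h.+1).[x])^-1.
have rem_cvg0 : rem @ \oo --> (0 : R).
  apply: strip_remainder_cvg0 => [|j jh].
    have x0 : 0 < 2 * x by lra.
    by rewrite invr_ge0 (ltW x0) /= lef_pV2 ?posrE //; lra.
  by rewrite ltW ?chebyshevU_gt0 //= subn0 chebyshevU_le // leq_subr.
have rem2_cvg0 : (fun n => rem (2 * n)%N) @ \oo --> (0 : R).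
  by apply: (cvg_comp _ _ _ rem_cvg0); exact: cvg_mulnl.
have : (fun n => cheb_ratio h.+1 x - inv * rem (2 * n)%N) @ \oo
    --> cheb_ratio h.+1 x - inv * 0.
  by apply: cvgB; [|apply: cvgM rem2_cvg0]; exact: cvg_cst.
rewrite mulr0 subr0; apply: cvg_trans.
by under eq_fun do rewrite cheb_partial_sum //.
Qed.
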